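(* Let $(u(n))_{n\ge0}$ be the integer sequence defined by $u(0)=1$ and $$u(n)=\prod_{j=1}^n(4j-1)^2-\sum_{m=0}^{n-1}\binom{2n+1}{2m+1}\Bigl(\prod_{j=1}^{n-m}(4j-3)^2\Bigr)u(m)\quad(n\ge1).$$ Then, given a prime $p\equiv1\pmod4$ and a positive integer $e$, the number $u(n)$ is divisible by $p^e$ for all $n\ge\left\lceil\frac{ep}{2}\right\rceil$. Moreover, the number $u\bigl(\frac{p-1}{2}\bigr)$ is a quadratic residue modulo $p$ and relatively prime to $p$. *)

(* Defs.v *)
From mathcomp Require Import all_boot all_order all_algebra.

Set Implicit Arguments.
Unset Strict Implicit.
Unset Printing Implicit Defensive.

Import Order.TTheory GRing.Theory Num.Theory.
Local Open Scope ring_scope.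

(* Zero counts as a residue here: coprimality to the modulus is a separate
   condition. *)
Definition quadratic_residue (m : nat) (a : int) : Prop :=
  exists x : int, (x ^+ 2 = a %[mod m%:Z])%Z.

(* Main.v *)
Require Import Defs.
From mathcomp Require Import all_boot all_order all_algebra.
From mathcomp Require Import zify ring.

(** Let [a n] and [b n] be the products of the [(4 * j - 1) ^+ 2] and of the
[(4 * j - 3) ^+ 2] for [j] from 1 to [n], and put

  [A = \sum_n a n * t^(2n+1) / (2n+1)!],
  [B = \sum_n b n * t^(2n) / (2n)!],
  [U = \sum_n u n * t^(2n+1) / (2n+1)!].

The recurrence for [u] says that [U * B = A].  Both [A] and [B] are solutions
of the differential equation [f'' = (2 * t * d/dt + 1)^2 f], so their Wronskian
[W = A' * B - A * B'] satisfies a first-order equation, which gives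
[W = 1 / (1 - 4 * t^2)].  Differentiating [U * B = A] and eliminating [A] yields
[U' * B^2 = W].

The divisibility by prime powers comes from this last identity.  Consider the
exponential generating functions whose [n]-th coefficient is divisible by
[p ^ (n %/ p)] for every [n].  They form a ring ([pfactor_graded_egf_mul]): when
the exponents [k %/ p] and [(n - k) %/ p] add up to less than [n %/ p], there is
a carry at the last digit of [k + (n - k)] in base [p], and then [p] divides
['C(n, k)].  Division by a member with constant coefficient 1 stays in the ring
([pfactor_graded_egf_div]).  It contains [W], whose [n]-th coefficient is
divisible by [n`!], and, for [p = 1 %[mod 4]], it contains [B], because the
factor [4 * j - 3] is already a multiple of [p] at [j = (p + 3) / 4], before
[p / 2], and enters squared: [b n] gains [p ^ 2] once every [p] steps, early
enough for the factor [p] due at [p / 2] and the next one due at [p].  Hence it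
contains [U'], whose coefficient of index [2 * n] is [u n], and
[uphalf (e * p) <= n] means [e <= (2 * n) %/ p].  The equation [U * B = A] alone
would not do, since [A] is not in the ring.

The residue of [u ((p - 1) / 2)] is read off the recurrence itself: the binomial
coefficients there are ['C(p, k)] with [0 < k < p], so modulo [p] only the
product remains.  It is a square, and its factors [4 * j - 1] lie below [2 * p]
and differ from [p] modulo 4, so none is a multiple of [p]. *)

Set Implicit Arguments.
Unset Strict Implicit.
Unset Printing Implicit Defensive.

Import Order.TTheory GRing.Theory Num.Theory.
Local Open Scope ring_scope.

(** * Exponential generating functions *)

(** A sequence [f] stands for the formal series [\sum_n f n * t^n / n!]; then
differentiation is a shift, and no denominators appear. *)
Definition egf_deriv (R : Type) (f : nat -> R) : nat -> R := fun n => f n.+1.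

Definition egf_mul (R : comNzRingType) (f g : nat -> R) : nat -> R :=
  fun n => \sum_(k < n.+1) 'C(n, k)%:R * f k * g (n - k)%N.

Local Notation "f ** g" := (egf_mul f g) (at level 40, left associativity).

Section EgfAlgebra.
Variable R : comNzRingType.
Implicit Types f g h : nat -> R.

Lemma eq_egf_mul f f' g g' : f =1 f' -> g =1 g' -> f ** g =1 f' ** g'.
Proof. by move=> ff gg n; apply: eq_bigr => k _; rewrite ff gg. Qed.

Lemma egf_mul0 f g : (f ** g) 0%N = f 0%N * g 0%N.
Proof. by rewrite /egf_mul big_ord1 bin0 mul1r. Qed.

(** The Leibniz rule is Pascal's rule. *)
Lemma egf_mulS f g n :
  (f ** g) n.+1 = (egf_deriv f ** g) n + (f ** egf_deriv g) n.
Proof.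
rewrite /egf_mul /egf_deriv big_ord_recl /=.
under eq_bigr => i _.
  rewrite /bump /= add1n binS natrD !mulrDl subSS.
  over.
rewrite big_split /= addrA addrC; congr (_ + _).
rewrite big_ord_recr /= (bin_small (ltnSn n)) !mul0r addr0 [RHS]big_ord_recl /=.
rewrite !bin0 !subn0.
congr (_ + _); apply: eq_bigr => i _.
by rewrite /bump /= add1n -subSn // ltn_ord.
Qed.

Lemma egf_mulDl f g h n :
  ((fun i => f i + g i) ** h) n = (f ** h) n + (g ** h) n.
Proof. by rewrite /egf_mul -big_split; apply: eq_bigr => k _ /=; ring. Qed.

Lemma egf_mulDr f g h n :
  (f ** (fun i => g i + h i)) n = (f ** g) n + (f ** h) n.
Proof. by rewrite /egf_mul -big_split; apply: eq_bigr => k _ /=; ring. Qed.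

(** A series is determined by its value at 0 and its derivative, so this and
[egf_mulA] follow from the Leibniz rule by induction. *)
Lemma egf_mulC f g : f ** g =1 g ** f.
Proof.
move=> n; elim: n f g => [|n IHn] f g; first by rewrite !egf_mul0 mulrC.
by rewrite !egf_mulS addrC IHn [X in _ + X]IHn.
Qed.

Lemma egf_mulA f g h : f ** (g ** h) =1 (f ** g) ** h.
Proof.
move=> n; elim: n f g h => [|n IHn] f g h; first by rewrite !egf_mul0 mulrA.
have DM f1 f2 : egf_deriv (f1 ** f2) =1
    (fun i => (egf_deriv f1 ** f2) i + (f1 ** egf_deriv f2) i).
  by move=> i; rewrite -egf_mulS.
rewrite !egf_mulS (eq_egf_mul (fun=> erefl) (DM g h)).
rewrite (eq_egf_mul (DM f g) (fun=> erefl)) egf_mulDl egf_mulDr.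
by rewrite -!IHn addrA.
Qed.

(** This is [(t * f') * g = t * (f' * g)], read on coefficients. *)
Lemma egf_mul_euler f g n :
  ((fun i => i%:R * f i) ** g) n.+1 = n.+1%:R * (egf_deriv f ** g) n.
Proof.
rewrite /egf_mul big_ord_recl /= mul0r mulr0 mul0r add0r mulr_sumr.
apply: eq_bigr => i _; rewrite /bump /= add1n subSS /egf_deriv.
have := congr1 (fun m => m%:R : R) (mul_bin_diag n.+1 i).
by rewrite /= !natrM => e; rewrite !mulrA e; ring.
Qed.

End EgfAlgebra.

(** * The Wronskian *)

Section Wronskian.
Variable R : comNzRingType.
Variables f g : nat -> R.

Definition wronskian n := (egf_deriv f ** g) n - (f ** egf_deriv g) n.

Hypothesis f_ode : forall k, f k.+2 = (2 * k%:R + 1) ^+ 2 * f k.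
Hypothesis g_ode : forall k, g k.+2 = (2 * k%:R + 1) ^+ 2 * g k.

Lemma wronskianS n : wronskian n.+1 =
  4 * n.+1%:R *
    (((fun i => i%:R * f i) ** g) n - (f ** (fun i => i%:R * g i)) n).
Proof.
have -> : wronskian n.+1 = (egf_deriv (egf_deriv f) ** g) n
                           - (f ** egf_deriv (egf_deriv g)) n.
  by rewrite /wronskian !egf_mulS; ring.
rewrite /egf_mul -!sumrB mulr_sumr; apply: eq_bigr => -[k /= lekn] _.
rewrite /egf_deriv f_ode g_ode.
(* With l = n - k, the two squares differ by 4 (k - l) (k + l + 1). *)
have -> : n.+1%:R = k%:R + (n - k)%N%:R + 1 :> R.
  by rewrite -natrD subnKC // -natr1.
ring.
Qed.

(** From the initial values 1 and 0 this recursion produces the coefficients of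
[1 / (1 - 4 * t^2)]. *)
Lemma wronskianSS n : wronskian n.+2 = 4 * n.+2%:R * n.+1%:R * wronskian n.
Proof.
rewrite wronskianS egf_mul_euler [(f ** _) _]egf_mulC egf_mul_euler.
by rewrite [(egf_deriv g ** f) n]egf_mulC /wronskian; ring.
Qed.

Lemma wronskian1 : wronskian 1 = 0.
Proof. by rewrite wronskianS !egf_mul0 /= !mul0r mulr0 subrr mulr0. Qed.

End Wronskian.

(** The quotient rule, cleared of denominators. *)
Lemma wronskian_quotient (R : comNzRingType) (f g h : nat -> R) :
  h ** g =1 f -> wronskian f g =1 egf_deriv h ** (g ** g).
Proof.
move=> hg n; rewrite /wronskian.
have Df : egf_deriv f =1
    (fun i => (egf_deriv h ** g) i + (h ** egf_deriv g) i).
  by move=> i; rewrite -egf_mulS hg.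
rewrite (eq_egf_mul Df (fun=> erefl)) egf_mulDl -egf_mulA.
rewrite -(eq_egf_mul hg (fun=> erefl)) -!egf_mulA.
by rewrite (eq_egf_mul (fun=> erefl) (egf_mulC g _)) addrK.
Qed.

Lemma fact_dvd_wronskian (f g : nat -> int) :
  (forall k, f k.+2 = (2 * k%:R + 1) ^+ 2 * f k) ->
  (forall k, g k.+2 = (2 * k%:R + 1) ^+ 2 * g k) ->
  forall n, (n`!%:Z %| wronskian f g n)%Z.
Proof.
move=> fE gE n.
suff [] : (n`!%:Z %| wronskian f g n)%Z /\ (n.+1`!%:Z %| wronskian f g n.+1)%Z.
  by [].
elim: n => [|n [IHn IHSn]]; first by rewrite wronskian1 ?dvdz0 // dvd1z.
split=> //; rewrite wronskianSS // !factS !PoszM mulrA -!mulrA dvdz_mull //.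
by rewrite !natz !dvdz_mul.
Qed.

(** * Series whose coefficients gain a factor p every p steps *)

(** Half of Lucas' theorem: [n %% p < k %% p] is a borrow at the last digit of
[n - k] in base [p].  Iterating [k * 'C(n, k) = n * 'C(n.-1, k.-1)] lowers
[n %% p] to 0 while [k] stays prime to [p]. *)
Lemma prime_dvd_bin_borrow p n k :
  prime p -> (n %% p < k %% p)%N -> (p %| 'C(n, k))%N.
Proof.
move=> p_pr; have p_gt0 := prime_gt0 p_pr.
elim: n k => [|n IHn] [|k]; rewrite ?mod0n // => ltnk.
have pNk : ~~ (p %| k.+1)%N by rewrite /dvdn; case: eqP ltnk => // ->.
suff: (p %| k.+1 * 'C(n.+1, k.+1))%N by rewrite Euclid_dvdM // (negPf pNk).
rewrite -mul_bin_diag; have [pn|pNn] := boolP (p %| n.+1)%N.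
  exact: dvdn_mulr.
have predmod m : ~~ (p %| m.+1)%N -> (m.+1 %% p = (m %% p).+1)%N.
  by rewrite modnS => /negPf->.
by rewrite dvdn_mull // IHn //; rewrite !predmod // ltnS in ltnk.
Qed.

Section PfactorGraded.
Variable p : nat.
Hypothesis p_pr : prime p.

Definition pfactor_graded (f : nat -> int) :=
  forall n, (p%:Z ^+ (n %/ p) %| f n)%Z.

Lemma pfactor_dvd_bin n k : (k <= n)%N ->
  (p ^ (n %/ p) %| 'C(n, k) * (p ^ (k %/ p) * p ^ ((n - k) %/ p)))%N.
Proof.
move=> lekn; have p_gt0 := prime_gt0 p_pr; rewrite -expnD.
have En : (n %/ p = k %/ p + (n - k) %/ p + (p <= k %% p + (n - k) %% p))%N.
  by rewrite -{1}(subnKC lekn) divnD.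
rewrite En; case: leqP => [carry|_]; last by rewrite addn0 dvdn_mull.
rewrite addn1 expnS dvdn_mul //; apply: prime_dvd_bin_borrow => //.
rewrite -(subnKC lekn) modnD // carry mul1n.
have := ltn_pmod (n - k) p_gt0; lia.
Qed.

Lemma pfactor_graded_term (f g : nat -> int) n k : (k <= n)%N ->
  (p%:Z ^+ (k %/ p) %| f k)%Z -> (p%:Z ^+ ((n - k) %/ p) %| g (n - k)%N)%Z ->
  (p%:Z ^+ (n %/ p) %| 'C(n, k)%:R * f k * g (n - k)%N)%Z.
Proof.
move=> lekn /dvdzP[x ->] /dvdzP[y ->].
have dvd_bin : (p%:Z ^+ (n %/ p) %|
    'C(n, k)%:R * (p%:Z ^+ (k %/ p) * p%:Z ^+ ((n - k) %/ p)))%Z.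
  by rewrite natz dvdzE !abszM !abszX; exact: pfactor_dvd_bin.
have -> (c X Y : int) : c * (x * X) * (y * Y) = (x * y) * (c * (X * Y)).
  by ring.
exact: dvdz_mull.
Qed.

Lemma pfactor_graded_egf_mul f g :
  pfactor_graded f -> pfactor_graded g -> pfactor_graded (f ** g).
Proof.
move=> fP gP n; apply: rpred_sum => -[k /= ltkn] _.
exact: pfactor_graded_term.
Qed.

Lemma pfactor_graded_egf_div f g :
  g 0%N = 1 -> pfactor_graded g -> pfactor_graded (f ** g) -> pfactor_graded f.
Proof.
move=> g0 gP fgP n; elim/ltn_ind: n => n IHn.
have := fgP n; rewrite /egf_mul big_ord_recr /= binn subnn g0 mul1r mulr1.
rewrite rpredDl //; apply: rpred_sum => -[k /= ltkn] _.
by apply: pfactor_graded_term; rewrite ?IHn // ltnW.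
Qed.

Lemma pfactor_graded_fact f :
  (forall n, (n`!%:Z %| f n)%Z) -> pfactor_graded f.
Proof.
move=> fact_f n; apply: dvdz_trans (fact_f n).
rewrite dvdzE abszX pfactor_dvdn ?fact_gt0 // logn_fact //.
have [->|n_gt0] := posnP n; first by rewrite div0n.
by rewrite big_ltn ?expn1 ?leq_addr.
Qed.

End PfactorGraded.

(** * The two products *)

Section Products.

Definition prod_3mod4 n : int := \prod_(1 <= j < n.+1) (4 * j%:Z - 1) ^+ 2.
Definition prod_1mod4 n : int := \prod_(1 <= j < n.+1) (4 * j%:Z - 3) ^+ 2.

Definition odd_egf (c : nat -> int) k := if odd k then c k./2 else 0.
Definition even_egf (c : nat -> int) k := if odd k then 0 else c k./2.

Lemma odd_egf_ode k :
  odd_egf prod_3mod4 k.+2 = (2 * k%:R + 1) ^+ 2 * odd_egf prod_3mod4 k.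
Proof.
rewrite /odd_egf /= negbK; case: ifP => [ko|_]; last by rewrite mulr0.
rewrite /prod_3mod4 big_nat_recr //= mulrC; congr (_ ^+ 2 * _); lia.
Qed.

Lemma even_egf_ode k :
  even_egf prod_1mod4 k.+2 = (2 * k%:R + 1) ^+ 2 * even_egf prod_1mod4 k.
Proof.
rewrite /even_egf /= negbK; case: ifP => [_|ke]; first by rewrite mulr0.
rewrite /prod_1mod4 big_nat_recr //= mulrC; congr (_ ^+ 2 * _); lia.
Qed.

Lemma big_nat_double_parity (F : nat -> int) n :
  \sum_(0 <= k < n.*2) F k = \sum_(0 <= m < n) (F m.*2 + F m.*2.+1).
Proof.
elim: n => [|n IHn]; first by rewrite !big_geq.
by rewrite doubleS !big_nat_recr //= IHn addrA.
Qed.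

Lemma egf_mul_odd_even (c d : nat -> int) :
  odd_egf c ** even_egf d =1
  odd_egf (fun n => \sum_(0 <= m < n.+1)
                     'C(n.*2.+1, m.*2.+1)%:R * c m * d (n - m)%N).
Proof.
move=> k; rewrite {2}/odd_egf; case: ifP => ko; last first.
  rewrite /egf_mul big1 // => -[i /= leik] _; rewrite /odd_egf /even_egf.
  by rewrite oddB // ko; case: (odd i); rewrite /= ?mulr0 ?mul0r.
have {ko} -> : k = k./2.*2.+1 by rewrite -[LHS]odd_double_half ko.
move: k./2 => n; rewrite /= uphalf_double.
rewrite /egf_mul -(big_mkord xpredT (fun k => 'C(_, k)%:R * odd_egf c k *
  even_egf d (n.*2.+1 - k)%N)) -doubleS big_nat_double_parity.
apply: eq_big_nat => m; rewrite ltnS /= => lemn.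
rewrite /odd_egf /even_egf /= odd_double /= mulr0 mul0r add0r uphalf_double.
by rewrite subSS -doubleB odd_double doubleK.
Qed.

Variable p : nat.
Hypotheses (p_pr : prime p) (p_mod4 : p = 1 %[mod 4]).

(** The multiples of [p] among the [4 * j - 3] occur at
[j = (p + 3) / 4 + i * p], that is, at the [j] with [j + 3 * (p %/ 4)] divisible
by [p]; each of them is squared. *)
Lemma pfactor_dvd_prod_1mod4 e n : (e * p <= n + 3 * (p %/ 4))%N ->
  (p%:Z ^+ (2 * e) %| prod_1mod4 n)%Z.
Proof.
elim: e n => [|e IHe] n len; first exact: dvd1z.
have Ep : p = (4 * (p %/ 4) + 1)%N by rewrite {1}(divn_eq p 4) p_mod4 mulnC.
set j := (e * p + p %/ 4)%N.
have lejn : (j < n)%N by rewrite /j; lia.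
rewrite /prod_1mod4 (@big_cat_nat _ _ _ j.+1) //=; last by rewrite ltnW.
rewrite mulnS exprD mulrC [X in X * _]big_ltn // mulrAC dvdz_mulr //.
rewrite dvdz_mul //.
- apply: dvdz_exp2r; apply/dvdzP; exists (4 * e%:Z + 1).
  by rewrite /j; move: (p %/ 4)%N Ep => q ->; lia.
- by apply: IHe; rewrite /j; lia.
Qed.

Lemma pfactor_graded_prod_1mod4 : pfactor_graded p (even_egf prod_1mod4).
Proof.
move=> k; rewrite /even_egf; case: ifP => [_|ke]; first exact: dvdz0.
set n := k./2; have -> : k = n.*2 by rewrite -[LHS]odd_double_half ke.
have Ep : p = (4 * (p %/ 4) + 1)%N by rewrite {1}(divn_eq p 4) p_mod4 mulnC.
set e := ((n + 3 * (p %/ 4)) %/ p)%N.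
apply: (@dvdz_trans (p%:Z ^+ (2 * e))); last first.
  by apply: pfactor_dvd_prod_1mod4; apply: leq_divM.
apply: dvdz_exp2l; rewrite -ltnS ltn_divLR ?prime_gt0 //.
have : (n + 3 * (p %/ 4) < e.+1 * p)%N by rewrite ltn_ceil ?prime_gt0.
rewrite [(e.+1 * p)%N]mulSn [((2 * e).+1 * p)%N]mulSn -mulnA -muln2.
by move: (e * p)%N (p %/ 4)%N Ep => ep q ->; lia.
Qed.

Lemma prod_3mod4_coprime : coprimez (prod_3mod4 ((p - 1) %/ 2)) p%:Z.
Proof.
rewrite coprimez_sym /prod_3mod4 big_nat_cond.
apply: (big_ind (fun x => coprimez p%:Z x)).
- by rewrite coprimezE coprimen1.
- by move=> x y px py; rewrite coprimezMr px.
move=> j; rewrite andbT => /andP[j_gt0 ltj]; rewrite coprimezXr //.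
have -> : 4 * j%:Z - 1 = (4 * j - 1)%N%:Z by lia.
rewrite coprimezE prime_coprime //.
apply/negP => /dvdnP[c Ec].
have Ep : p = (4 * (p %/ 4) + 1)%N by rewrite {1}(divn_eq p 4) p_mod4 mulnC.
have lt2 : (c * p < 2 * p)%N by lia.
move: lt2; rewrite ltn_mul2r => /andP[_].
by case: c Ec => [|[|c]] //; lia.
Qed.

End Products.

Theorem theorem11 (u : nat -> int)
  (u0 : u 0%N = 1)
  (u_rec : forall n : nat, (1 <= n)%N ->
     u n = \prod_(1 <= j < n.+1) (4 * j%:Z - 1) ^+ 2
           - \sum_(0 <= m < n)
               'C(2 * n + 1, 2 * m + 1)%:Z
               * (\prod_(1 <= j < (n - m).+1) (4 * j%:Z - 3) ^+ 2)
               * u m)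
  (p : nat) (p_prime : prime p) (p_mod4 : p = 1 %[mod 4]) :
  (forall e : nat, (0 < e)%N ->
     forall n : nat, (uphalf (e * p) <= n)%N -> ((p%:Z ^+ e) %| u n)%Z)
  /\ quadratic_residue p (u ((p - 1) %/ 2)%N)
  /\ coprimez (u ((p - 1) %/ 2)%N) p%:Z.
Proof.
have p_gt1 := prime_gt1 p_prime.
have Ep : p = (4 * (p %/ 4) + 1)%N by rewrite {1}(divn_eq p 4) p_mod4 mulnC.
split.
  have UB : odd_egf u ** even_egf prod_1mod4 =1 odd_egf prod_3mod4.
    move=> k; rewrite egf_mul_odd_even /odd_egf; case: ifP => // _.
    move: k./2 => n; rewrite big_nat_recr //= binn subnn mul1r.
    rewrite [prod_1mod4 0]big_geq // mulr1.
    have [->|n_gt0] := posnP n.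
      by rewrite big_geq // u0 /prod_3mod4 big_geq.
    rewrite [u n]u_rec // [X in X + _](_ : _ = \sum_(0 <= m < n)
      'C(2 * n + 1, 2 * m + 1)%:Z * prod_1mod4 (n - m) * u m).
      by rewrite addrC subrK.
    apply: eq_bigr => m _.
    by rewrite natz !addn1 !mul2n mulrAC.
  have B0 : even_egf prod_1mod4 0 = 1 by rewrite /even_egf /prod_1mod4 big_geq.
  have BP := pfactor_graded_prod_1mod4 p_prime p_mod4.
  have U'P : pfactor_graded p (egf_deriv (odd_egf u)).
    apply: (pfactor_graded_egf_div p_prime
              (g := even_egf prod_1mod4 ** even_egf prod_1mod4)).
    - by rewrite egf_mul0 B0 mulr1.
    - exact: pfactor_graded_egf_mul.
    - move=> n; rewrite -(wronskian_quotient UB).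
      apply: (pfactor_graded_fact p_prime).
      by apply: fact_dvd_wronskian; [exact: odd_egf_ode|exact: even_egf_ode].
  move=> e _ n len; have := U'P n.*2.
  rewrite /egf_deriv /odd_egf /= odd_double /= uphalf_double.
  apply: dvdz_trans; apply: dvdz_exp2l.
  by rewrite leq_divRL ?prime_gt0 // -leq_uphalf_double.
set n := ((p - 1) %/ 2)%N.
have En : p = (2 * n + 1)%N by rewrite /n; lia.
have n_gt0 : (0 < n)%N by lia.
have cong : (u n = prod_3mod4 n %[mod p%:Z])%Z.
  apply/eqP; rewrite eqz_mod_dvd u_rec // addrC addKr rpredN big_nat_cond.
  apply: rpred_sum => m; rewrite andbT /= => ltmn.
  rewrite -En -mulrA dvdz_mulr //.
  by rewrite dvdzE prime_dvd_bin //; lia.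
split.
  exists (\prod_(1 <= j < n.+1) (4 * j%:Z - 1)).
  by rewrite cong -prodrXl.
have := prod_3mod4_coprime p_prime p_mod4.
by rewrite /coprimez -gcdz_modl -cong gcdz_modl.
Qed.
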